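(* Let $\Gamma$ be a finite subgroup of $SL_2(\mathbb C)$. (1) Via the dual McKay correspondence, the subset $\Gamma_*^{re}$ (resp. $\Gamma_*^{cx}$) of conjugacy classes of $\Gamma$ corresponds to the set of vertices of the Dynkin diagram which are fixed (resp. not fixed) by the diagram automorphism $\tau^\Gamma$. Here $\tau^\Gamma$ is the automorphism which exchanges the two end-points of the Dynkin diagram for $\Gamma=\mathbb Z_n$ ($n\ge2$), $BD_{8k+4}$, and $BT$, and is the trivial automorphism otherwise. (2) The set $\Gamma_*^{cx}$ is given as follows: $\{\langle A^i\rangle\mid 1\le i<2k+1\}$ for $\mathbb Z_{2k+1}$ ($k>0$); $\{\langle A^i\rangle\mid1\le i<2k,\ i\ne k\}$ for $\mathbb Z_{2k}$; $\{\langle B\rangle,\langle BA\rangle\}$ for $BD_{8k+4}$ ($k>0$); $\{\langle A\rangle,\langle B\rangle,\langle A^2\rangle,\langle B^2\rangle\}$ for $BT$; the empty set for $BD_{8k}$, $BO$ and $BI$. (3) The cardinalities of $\Gamma_*$, $\Gamma_*^{cx}$, $\Gamma_*^{re}$, together with the order $o(\tau^\Gamma)$ of $\tau^\Gamma$, are, listed in the order $|\Gamma_*|,\ |\Gamma_*^{cx}|,\ |\Gamma_*^{re}|,\ o(\tau^\Gamma)$: for $\mathbb Z_{2k+1}$: $2k+1,\ 2k,\ 0,\ 2$; for $\mathbb Z_{2k}$: $2k,\ 2k-2,\ 1,\ 2$; for $BD_{8k}$: $2k+3,\ 0,\ 2k+2,\ 1$; for $BD_{8k+4}$: $2k+4,\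 2,\ 2k+1,\ 2$; for $BT$: $7,\ 4,\ 2,\ 2$; for $BO$: $8,\ 0,\ 7,\ 1$; for $BI$: $9,\ 0,\ 8,\ 1$.
   Context: For a finite group $\Gamma$, $\Gamma_*$ is its set of conjugacy classes, $c^0=\{1\}$, $\bar c=\{x\mid x^{-1}\in c\}$, $\langle x\rangle$ is the conjugacy class of $x$; $\Gamma_*^{cx}=\{c\in\Gamma_*\mid c\ne\bar c\}$ and $\Gamma_*^{re}=\{c\in\Gamma_*\mid c\ne c^0,\ c=\bar c\}$. The finite subgroups of $SL_2(\mathbb C)$ (modulo conjugation) are in bijection with Dynkin diagrams of ADE types. They are: the cyclic groups $\mathbb Z_n$ of order $n$, the binary dihedral groups $BD_{4n}$ of order $4n$ ($n\ge3$), the binary tetrahedral group $BT$, the binary octahedral group $BO$ and the binary icosahedral group $BI$. Their Dynkin diagrams, orders and listed relations among generators are as follows, with $Z=-I$ the negative of the identity matrix, so $Z^2=1$ (generator $A$ for the cyclic group, $A,B$ for the binary dihedral group, and $A,B,C$ for the binary polyhedral groups): $\mathbb Z_n$ (diagram $A_{n-1}$, order $n$, $A^n=1$); $BD_{4n}$ (diagram $D_{n+2}$, order $4n$, $A^n=B^2=(AB)^2=Z$); $BT$ ($E_6$, order 24, $A^3=B^3=C^2=Z$); $BO$ ($E_7$, order 48, $A^4=B^3=C^2=Z$); $BI$ ($E_8$, order 120, $A^5=B^3=C^2=Z$). The dual McKay correspondence is the following bijection between the nontrivial conjugacy classes of $\Gamma$ and the vertices of the Dynkin diagram (each vertex labelled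 by a representative of the class): - $A_{n-1}$: a chain with successive vertices $A,A^2,\dots,A^{n-1}$. - $D_{n+2}$: a chain with successive vertices $A,A^2,\dots,A^{n-1},Z$, together with two further vertices $BA$ and $B$, each joined to $Z$. - $E_6$: a chain $B,B^2,Z,A^2,A$, together with a vertex $C$ joined to $Z$. - $E_7$: a chain $B,B^2,Z,A^3,A^2,A$, together with a vertex $C$ joined to $Z$. - $E_8$: a chain $B,B^2,Z,A^4,A^3,A^2,A$, together with a vertex $C$ joined to $Z$. In view of part (2), the two end-points exchanged by $\tau^\Gamma$ are $A$ and $A^{n-1}$ for $\mathbb Z_n$, $B$ and $BA$ for $BD_{8k+4}$, and $A$ and $B$ for $BT$.
   Formalization: In (3), o(τ) = 2 fails for Z_2 (one-vertex diagram) and Z_1; there o(τ) = 1 is stated. For BT, BO and BI the generators also satisfy ABC = Z, since the listed relations alone allow A = B in BT, where (2) fails. *)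

(* Defs.v *)
From HB Require Import structures.
From mathcomp Require Import all_boot all_order all_algebra all_fingroup.
From mathcomp Require Import mxrepresentation complex reals.
Set Implicit Arguments.
Unset Strict Implicit.
Unset Printing Implicit Defensive.

Local Open Scope group_scope.

(* [c^-1] is the pointwise inverse of the set [c], i.e. [set x | x^-1 \in c]. *)
Definition classes_cx (gT : finGroupType) (G : {group gT}) : {set {set gT}} :=
  [set c in classes G | c != c^-1].

Definition classes_re (gT : finGroupType) (G : {group gT}) : {set {set gT}} :=
  [set c in classes G | (c != [set 1]) && (c == c^-1)].

(* [ZZ n] is the cyclic group of order n (diagram A_(n-1)), [BD n] the binary
   dihedral group of order 4n (diagram D_(n+2)); [BT], [BO], [BI] have diagrams
   E_6, E_7, E_8. *)
Inductive ade := ZZ of nat | BD of nat | BT | BO | BI.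

(* [generators rG t A B C Z]: the group G, embedded in GL_2 by rG, is of type t
   with standard generators A, B, C and Z = -I. For [ZZ n] the elements B, C, Z
   are unused, and for [BD n] C is unused. The binary polyhedral presentation
   includes ABC = Z (equivalently C = AB): without it A and B could be conjugate
   in BT, and C could be conjugate to A^2 in BO. *)
Definition generators (F : fieldType) (gT : finGroupType) (G : {group gT})
    (rG : mx_representation F G 2) (t : ade) (A B C Z : gT) : Prop :=
  let Z_is_minus_I := Z \in G /\ rG Z = (- 1%:M)%R in
  match t with
  | ZZ n => [/\ (0 < n)%N, #|G| = n, G :=: <<[set A]>> & A ^+ n = 1]
  | BD n =>
      [/\ (1 < n)%N, #|G| = (4 * n)%N, G :=: <<[set A; B]>>, Z_is_minus_I
        & [/\ A ^+ n = Z, B ^+ 2 = Z & (A * B) ^+ 2 = Z]]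
  | BT =>
      [/\ #|G| = 24, G :=: <<[set A; B; C]>>, Z_is_minus_I
        & [/\ A ^+ 3 = Z, B ^+ 3 = Z, C ^+ 2 = Z & A * B * C = Z]]
  | BO =>
      [/\ #|G| = 48, G :=: <<[set A; B; C]>>, Z_is_minus_I
        & [/\ A ^+ 4 = Z, B ^+ 3 = Z, C ^+ 2 = Z & A * B * C = Z]]
  | BI =>
      [/\ #|G| = 120, G :=: <<[set A; B; C]>>, Z_is_minus_I
        & [/\ A ^+ 5 = Z, B ^+ 3 = Z, C ^+ 2 = Z & A * B * C = Z]]
  end.

(* The vertices of the Dynkin diagram of type t are the i < rank t: those with
   i < chain_length t form a chain 0 - 1 - 2 - ..., and each remaining one is
   joined to the vertex [branch t] only (there are none of these for [ZZ n]). *)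
Definition rank (t : ade) : nat :=
  match t with ZZ n => n.-1 | BD n => n.+2 | BT => 6 | BO => 7 | BI => 8 end.

Definition chain_length (t : ade) : nat :=
  match t with ZZ n => n.-1 | BD n => n | BT => 5 | BO => 6 | BI => 7 end.

Definition branch (t : ade) : nat :=
  match t with BD n => n.-1 | _ => 2 end.

Definition dynkin_edge (t : ade) : rel 'I_(rank t) := fun i j =>
  let joined (a b : nat) :=
    if (b < chain_length t)%N then a.+1 == b else a == branch t in
  joined i j || joined j i.

Definition labels (gT : finGroupType) (A B C Z : gT) (t : ade) : seq gT :=
  match t with
  | ZZ n => [seq A ^+ i | i <- iota 1 n.-1]
  | BD n => [seq A ^+ i | i <- iota 1 n.-1] ++ [:: Z; B * A; B]
  | BT => [:: B; B ^+ 2; Z; A ^+ 2; A; C]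
  | BO => [:: B; B ^+ 2; Z; A ^+ 3; A ^+ 2; A; C]
  | BI => [:: B; B ^+ 2; Z; A ^+ 4; A ^+ 3; A ^+ 2; A; C]
  end.

Definition dual_mckay (gT : finGroupType) (G : {group gT}) (A B C Z : gT)
    (t : ade) (i : 'I_(rank t)) : {set gT} :=
  nth 1 (labels A B C Z t) i ^: G.

(* The end-points exchanged by tau: the vertices labelled A and A^(n-1) for
   [ZZ n], BA and B for [BD n] with n odd, B and A for [BT]. *)
Definition exchanged_ends (t : ade) : option (nat * nat) :=
  match t with
  | ZZ n => if (1 < n)%N then Some (0, n.-2)%N else None
  | BD n => if odd n then Some (n, n.+1) else None
  | BT => Some (0, 4)%N
  | BO | BI => None
  end.

Definition is_tau (t : ade) (tau : {perm 'I_(rank t)}) : Prop :=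
  (forall i j, dynkin_edge (tau i) (tau j) = dynkin_edge i j) /\
  match exchanged_ends t with
  | Some (a, b) =>
      forall i : 'I_(rank t), (i = a :> nat -> tau i = b :> nat) /\
                              (i = b :> nat -> tau i = a :> nat)
  | None => tau = 1
  end.

(* Main.v *)
Require Import Defs.
From HB Require Import structures.
From mathcomp Require Import all_boot all_order all_algebra all_fingroup.
From mathcomp Require Import mxrepresentation complex reals.
From mathcomp Require Import cyclic.
From mathcomp Require Import zify ring.

(** The theorem follows from three facts about each type of group: the labels of
    the Dynkin diagram represent the nontrivial conjugacy classes, each exactly
    once; the label at tau(i) is conjugate to the inverse of the label at i;
    and tau is the only diagram automorphism with the prescribed effect on the
    end-points. Indeed a class is then real if and only if its vertex is
    fixed by tau, and the lists and cardinalities are read off from the action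
    of tau on the vertices. The first two facts form [mckay_data].

    Uniqueness ([is_tau_unique]) holds because an automorphism fixing the end-points
    that tau exchanges is trivial: being fixed spreads along the diagram from
    a vertex to its last neighbour not known to be fixed.

    For cyclic groups classes are singletons ([cyclic_mckay]); for binary
    dihedral groups G is the union of the cosets <[A]> and B <[A]>, with
    A^B = A^-1, and the classes are explicit ([dihedral_mckay]).

    For BT, BO and BI, Z acts as -1, C = AB, and neither A nor B is scalar,
    since otherwise G would be cyclic of too small an order. By Cayley-Hamilton,
    A^p = B^3 = -1 and determinant 1 then force tr B = 1 and tr A = t with t = 1,
    t^2 = 2 or t^2 = t + 1 for p = 3, 4, 5. Together with (AB)^2 = -1 this
    determines the multiplication of the algebra spanned by 1, A, B and AB,
    so every word in A and B has normal form a + b A + c B + d AB with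
    coefficients in Z[t] ([repr_word_eval]). An explicit list of #|G| words is
    closed, up to normal form, under right multiplication by A and B; hence it
    represents every element of G exactly once, and two words are equal in G if
    and only if they have the same normal form ([word_eval_nf]). The conjugacy
    classes are then obtained by computation ([polyhedral_mckay]).

    The argument uses only that the representation is faithful with values in
    SL_2, and is valid over every field. *)

Set Implicit Arguments.
Unset Strict Implicit.
Unset Printing Implicit Defensive.

Local Open Scope group_scope.

(** * The diagram automorphism *)

(** A permutation of the vertices preserving adjacency in the Dynkin diagram. *)
Definition automorphism (t : ade) (s : {perm 'I_(rank t)}) : Prop :=
  forall i j, dynkin_edge (s i) (s j) = dynkin_edge i j.

(** An automorphism permutes the neighbours of a fixed vertex; if it fixes all
    of them but one, it fixes that one too. *)
Lemma automorphism_fix_neighbour (t : ade) (s : {perm 'I_(rank t)}) x y :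
    automorphism s -> s x = x -> dynkin_edge x y ->
    (forall z, dynkin_edge x z -> z != y -> s z = z) ->
  s y = y.
Proof.
move=> s_aut sx xy fix_z; have sxy : dynkin_edge x (s y) by rewrite -{1}sx s_aut.
have [//|syNy] := eqVneq (s y) y.
exact: perm_inj (fix_z _ sxy syNy).
Qed.

(** The automorphism tau on vertex numbers: it reverses the chain of A_(n-1),
    swaps the two vertices BA and B of D_(n+2) for odd n, reverses the chain of
    five vertices of E_6, and is the identity in the other cases. Values at numbers that are not vertices are
    irrelevant. *)
Definition tau_nat (t : ade) (i : nat) : nat :=
  match t with
  | ZZ n => n.-2 - i
  | BD n => if odd n then if i == n then n.+1 else if i == n.+1 then n else i
            else i
  | BT => if i < 5 then 4 - i else i
  | BO | BI => i
  end.

(** Linear arithmetic after splitting on the tests of all conditionals. *)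
Ltac lia_if := repeat case: ifP; lia.

Lemma tau_nat_lt t i : i < rank t -> tau_nat t i < rank t.
Proof. by case: t => [n|n|||] /=; lia_if. Qed.

Lemma tau_natK t i : i < rank t -> tau_nat t (tau_nat t i) = i.
Proof. by case: t => [n|n|||] /=; lia_if. Qed.

Definition tau_fun (t : ade) (i : 'I_(rank t)) : 'I_(rank t) :=
  Ordinal (tau_nat_lt (ltn_ord i)).

Lemma tau_funK t : involutive (@tau_fun t).
Proof. by move=> i; apply/val_inj/tau_natK/ltn_ord. Qed.

(** tau as a permutation of the vertices. *)
Definition tau_perm (t : ade) : {perm 'I_(rank t)} :=
  perm (can_inj (@tau_funK t)).

Lemma val_tau_perm t (i : 'I_(rank t)) : tau_perm t i = tau_nat t i :> nat.
Proof. by rewrite permE. Qed.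

Lemma tau_permK t : involutive (@tau_perm t).
Proof. by move=> i; rewrite !permE tau_funK. Qed.

Lemma tau_perm_aut t : automorphism (tau_perm t).
Proof.
move=> [i lti] [j ltj]; rewrite /dynkin_edge !val_tau_perm /=.
by case: t lti ltj => [n|n|||] /=; lia_if.
Qed.

(** The range of n in which ZZ n and BD n denote a type of group. *)
Definition valid (t : ade) : Prop :=
  match t with ZZ n => 0 < n | BD n => 1 < n | _ => True end.

Lemma is_tau_perm t : is_tau (tau_perm t).
Proof.
split; first exact: tau_perm_aut.
case: t => [n|n|||]; rewrite /exchanged_ends; last 3 first.
- by move=> i; rewrite !val_tau_perm /=; lia_if.
- by apply/permP => i; apply: val_inj; rewrite perm1 [LHS]val_tau_perm.
- by apply/permP => i; apply: val_inj; rewrite perm1 [LHS]val_tau_perm.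
- case: ltnP => n1; first by move=> i; rewrite !val_tau_perm /=; lia.
  by apply/permP => -[i lti]; move: (lti); rewrite /=; lia.
- case: ifP => n_odd; first by move=> i; rewrite !val_tau_perm /= n_odd; lia_if.
  by apply/permP => i; apply: val_inj; rewrite perm1 [LHS]val_tau_perm /= n_odd.
Qed.

(** Starting from the exchanged end-points, [automorphism_fix_neighbour] spreads
    along the diagram: an automorphism fixing these end-points is trivial. *)
Lemma automorphism_fix_ends t a b (s : {perm 'I_(rank t)}) :
    valid t -> exchanged_ends t = Some (a, b) -> automorphism s ->
    (forall i : 'I_(rank t), i = a :> nat \/ i = b :> nat -> s i = i) ->
  s = 1.
Proof.
move=> t_ok ends s_aut fix_ab; apply/permP => i; rewrite perm1.
suff: forall m (lt_m : m < rank t), s (Ordinal lt_m) = Ordinal lt_m.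
  by move=> fixm; case: i => m lt_m; apply: fixm.
move=> {i}.
have step x y (ltx : x < rank t) (lty : y < rank t) :
    s (Ordinal ltx) = Ordinal ltx -> dynkin_edge (Ordinal ltx) (Ordinal lty) ->
    (forall z (ltz : z < rank t), dynkin_edge (Ordinal ltx) (Ordinal ltz) ->
        z != y -> s (Ordinal ltz) = Ordinal ltz) ->
    s (Ordinal lty) = Ordinal lty.
  move=> sx xy fix_z; apply: (automorphism_fix_neighbour s_aut sx xy).
  by move=> [z ltz] xz zy; apply: fix_z.
have fix_end x (ltx : x < rank t) : x = a \/ x = b -> s (Ordinal ltx) = Ordinal ltx.
  by move=> x_end; apply: fix_ab.
move: fix_end step => {fix_ab s_aut}.
case: t t_ok ends s => [n|n|||] //= t_ok.
- case: ifP => // n1 [<- <-] s fix_end step.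
  elim/ltn_ind => -[|m] IHm lt_m; first by apply: fix_end; left.
  have lt_m' : m < n.-1 by lia.
  apply: (step m _ lt_m'); first exact: IHm.
    by rewrite /dynkin_edge /=; lia_if.
  move=> z ltz; rewrite /dynkin_edge /= => mz zm; apply: IHm; move: mz; lia_if.
- case: ifP => // n_odd [<- <-] s fix_end step.
  (* The chain is explored from Z = A^n, numbered n.-1, down to A; k is the
     distance to Z. *)
  have fix_chain k m (ltm : m < n.+2) : m = n.-1 - k -> s (Ordinal ltm) = Ordinal ltm.
    elim/ltn_ind: k m ltm => -[|k] IHk m ltm mE.
      have ltn2 : n < n.+2 by lia.
      apply: (step n _ ltn2); first by apply: fix_end; left.
        by rewrite /dynkin_edge /=; lia_if.
      by move=> z ltz; rewrite /dynkin_edge /=; lia_if.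
    have [le_nk|lt_kn] := leqP n.-1 k; first by apply: (IHk k); lia.
    have ltm' : m.+1 < n.+2 by lia.
    apply: (step m.+1 _ ltm'); first by apply: (IHk k); lia.
      by rewrite /dynkin_edge /=; lia_if.
    move=> z ltz; rewrite /dynkin_edge /= => z_edge zm.
    have [lt_zn|le_nz] := ltnP z n; last by apply: fix_end; lia.
    by apply: (IHk k.-1); move: z_edge; lia_if.
  move=> m ltm; have [lt_mn|le_nm] := ltnP m n; last by apply: fix_end; lia.
  by apply: (fix_chain (n.-1 - m)); lia.
- case=> <- <- s fix_end step.
  have f0 ltm : s (@Ordinal 6 0 ltm) = Ordinal ltm by apply: fix_end; left.
  have f4 ltm : s (@Ordinal 6 4 ltm) = Ordinal ltm by apply: fix_end; right.
  have f1 ltm : s (@Ordinal 6 1 ltm) = Ordinal ltm.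
    apply: (step 0%N 1%N isT ltm) => // z ltz; rewrite /dynkin_edge /=; lia_if.
  have f3 ltm : s (@Ordinal 6 3 ltm) = Ordinal ltm.
    apply: (step 4 3 isT ltm) => // z ltz; rewrite /dynkin_edge /=; lia_if.
  have f2 ltm : s (@Ordinal 6 2 ltm) = Ordinal ltm.
    apply: (step 1%N 2 isT ltm) => // -[|z] ltz //; rewrite /dynkin_edge /=; lia_if.
  have f5 ltm : s (@Ordinal 6 5 ltm) = Ordinal ltm.
    apply: (step 2 5 isT ltm) => // z ltz; rewrite /dynkin_edge /= => zE z5.
    have [z1|z3] : z = 1%N \/ z = 3 by move: zE; lia_if.
      by subst z.
    by subst z.
  by do 6?[case=> //].
Qed.

Lemma is_tau_unique t s : valid t -> is_tau s -> tau_perm t = s.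
Proof.
move=> t_ok [s_aut s_ends]; have [_ tau_ends] := is_tau_perm t.
case ends: (exchanged_ends t) s_ends tau_ends => [[a b]|] s_ends tau_ends.
  (* s and tau agree on the end-points, so s * tau fixes them; tau being an
     involution, s * tau = 1 gives s = tau. *)
  suff e : s * tau_perm t = 1.
    apply/permP=> i; rewrite -[RHS]tau_permK; congr (tau_perm t _).
    by rewrite -permM e perm1.
  apply: (automorphism_fix_ends t_ok ends) => [i j|i i_end].
    by rewrite !permM tau_perm_aut s_aut.
  have [sa sb] := s_ends i; rewrite permM; apply: val_inj.
  have [taua taub] := tau_ends (s i).
  by case: i_end => i_end; rewrite /= ?(taua (sb i_end)) ?(taub (sa i_end)).
by rewrite tau_ends s_ends.
Qed.

(** * Consequences of the bijection *)

(** The core of the theorem: the dual McKay map is a bijection onto the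
    nontrivial conjugacy classes, and it carries tau to inversion of classes. *)
Definition mckay_data (gT : finGroupType) (G : {group gT}) (A B C Z : gT) t :=
  [/\ injective (@dual_mckay gT G A B C Z t),
      [set dual_mckay G A B C Z i | i : 'I_(rank t)] = classes G :\ [set 1]
    & forall i : 'I_(rank t),
        dual_mckay G A B C Z (tau_perm t i) = (dual_mckay G A B C Z i)^-1].

(** The same in terms of labels: they form a system of representatives of the
    nontrivial classes, and the inverse of each label is conjugate to the label
    of the image vertex under tau. *)
Lemma mckay_data_labels (gT : finGroupType) (G : {group gT}) (A B C Z : gT) t :
    let l i := nth 1 (labels A B C Z t) i in
    (forall i, i < rank t -> l i \in G /\ l i != 1) ->
    (forall i j, i < rank t -> j < rank t -> l i \in l j ^: G -> i = j) ->
    (forall x, x \in G -> x != 1 -> exists2 i, i < rank t & x \in l i ^: G) ->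
    (forall i, i < rank t -> (l i)^-1 \in l (tau_nat t i) ^: G) ->
  mckay_data G A B C Z t.
Proof.
move=> l lG l_inj l_surj l_inv; split.
- move=> i j /= eq_ij; apply/val_inj/l_inj; rewrite ?ltn_ord //.
  by apply/class_eqP.
- apply/setP => c; rewrite !inE; apply/imsetP/andP => [[i _ ->]|[ntc]].
    have [liG li1] := lG _ (ltn_ord i); split; last exact: mem_classes.
    by apply: contraNneq li1 => li_1; rewrite -(classG_eq1 G); apply/eqP.
  case/imsetP => x Gx def_c; rewrite {c}def_c in ntc *.
  have ntx : x != 1 by apply: contraNneq ntc => ->; rewrite class1G; apply/eqP.
  have [i lti /class_eqP x_li] := l_surj x Gx ntx.
  by exists (Ordinal lti).
move=> i; rewrite /dual_mckay val_tau_perm -classVg; apply/esym/class_eqP.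
exact: l_inv.
Qed.

Section DualMcKay.

Variables (gT : finGroupType) (G : {group gT}) (A B C Z : gT) (t : ade).
Let f := @dual_mckay gT G A B C Z t.
Let tau := tau_perm t.
Hypothesis data : mckay_data G A B C Z t.

Lemma classes_reE : [set f i | i : 'I_(rank t) & tau i == i] = classes_re G.
Proof.
case: data => f_inj f_im f_tau.
apply/setP => c; rewrite inE andbA [_ && (c != _)]andbC -in_setD1 -f_im.
apply/imsetP/andP => [[j]|[ /imsetP[i _ ->]]].
  rewrite inE => /eqP tauj ->; split; first exact: imset_f.
  by rewrite -f_tau tauj.
by rewrite -f_tau eq_sym (inj_eq f_inj) => taui; exists i; rewrite ?inE.
Qed.

Lemma classes_cxE : [set f i | i : 'I_(rank t) & tau i != i] = classes_cx G.
Proof.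
case: data => f_inj f_im f_tau.
apply/setP => c; rewrite inE.
have -> : (c \in classes G) && (c != c^-1)
        = (c \in classes G :\ [set 1]) && (c != c^-1).
  rewrite in_setD1; case: (eqVneq c [set 1]) => // ->.
  by rewrite invg_set1 invg1 eqxx andbF.
rewrite -f_im; apply/imsetP/andP => [[j]|[ /imsetP[i _ ->]]].
  rewrite inE => tauj ->; split; first exact: imset_f.
  by rewrite -f_tau eq_sym (inj_eq f_inj).
by rewrite -f_tau eq_sym (inj_eq f_inj) => taui; exists i; rewrite ?inE.
Qed.

Lemma card_classes : #|classes G| = (rank t).+1.
Proof.
case: data => f_inj f_im f_tau.
by rewrite (cardsD1 [set 1]) classes1 -f_im card_imset // card_ord.
Qed.

Lemma card_classes_cx : #|classes_cx G| = #|[set i | tau i != i]|.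
Proof.
case: data => f_inj f_im f_tau.
by rewrite -classes_cxE card_imset.
Qed.

Lemma card_classes_re : #|classes_re G| = #|[set i | tau i == i]|.
Proof.
case: data => f_inj f_im f_tau.
by rewrite -classes_reE card_imset.
Qed.

End DualMcKay.

Lemma card_tau_fixed t :
  #|[set i | tau_perm t i == i]| = count (fun i => tau_nat t i == i) (iota 0 (rank t)).
Proof.
rewrite cardsE cardE /enum_mem size_filter -val_enum_ord count_map enumT.
by apply: eq_count => i; rewrite /= -(val_tau_perm i).
Qed.

Lemma card_tau_moved t :
  #|[set i | tau_perm t i != i]| = count (fun i => tau_nat t i != i) (iota 0 (rank t)).
Proof.
rewrite cardsE cardE /enum_mem size_filter -val_enum_ord count_map enumT.
by apply: eq_count => i; rewrite /= -(val_tau_perm i).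
Qed.

(** * Cyclic and binary dihedral groups *)

(** In a finite group every element of a generated subgroup is a product of
    generators, without inverses. *)
Lemma gen_subset_closed (gT : finGroupType) (X S : {set gT}) :
    1 \in S -> (forall x y, x \in S -> y \in X -> x * y \in S) ->
  <<X>> \subset S.
Proof.
move=> S1 SM; apply/subsetP => x /gen_prodgP[n [c Xc ->]].
elim: n c Xc => [|n IHn] c Xc; first by rewrite big_ord0.
by rewrite big_ord_recr SM // IHn.
Qed.

Lemma nth_powers (gT : finGroupType) (A : gT) n i :
  i < n.-1 -> nth 1 [seq A ^+ i | i <- iota 1 n.-1] i = A ^+ i.+1.
Proof. by move=> lt_i; rewrite (nth_map 0%N) ?size_iota // nth_iota. Qed.

(** The classes are singletons, and A^(i+1) has inverse A^(n-1-i). *)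
Lemma cyclic_mckay (gT : finGroupType) (G : {group gT}) (A B C Z : gT) n :
    0 < n -> #|G| = n -> G :=: <<[set A]>> -> A ^+ n = 1 ->
  mckay_data G A B C Z (ZZ n).
Proof.
move=> n_gt0 oG genG An; rewrite -[<<_>>]/(<[A]>) in genG.
have oA : #[A] = n by rewrite -oG genG.
have GA i : A ^+ i \in G by rewrite genG mem_cycle.
have cGG : abelian G by rewrite genG cycle_abelian.
have clG x : x \in G -> x ^: G = [set x].
  by move=> Gx; apply/cent_classP; apply: (subsetP cGG).
have expA_eq i j : (A ^+ i == A ^+ j) = (i == j %[mod n]).
  by rewrite eq_expg_mod_order oA.
apply: mckay_data_labels => /= [i lti|i j lti ltj|x Gx ntx|i lti].
- by rewrite nth_powers // -(expg0 A) GA expA_eq mod0n modn_small; lia.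
- rewrite !nth_powers // clG // inE expA_eq !modn_small; lia.
- have /cyclePmin[i ] : x \in <[A]> by rewrite -genG.
  rewrite oA => lti def_x.
  have i0 : i != 0%N by apply: contraNneq ntx => i0; rewrite def_x i0.
  exists i.-1; first by lia.
  by rewrite nth_powers ?prednK -?genG ?def_x ?class_refl; lia.
- have lti' : n.-2 - i < n.-1 by lia.
  rewrite !nth_powers // clG // inE eq_invg_mul -expgD -(expg0 A) expA_eq.
  by have -> : i.+1 + (n.-2 - i).+1 = n by [lia]; rewrite modnn mod0n.
Qed.

Lemma nth_labels_BA (gT : finGroupType) (A B C Z : gT) n :
  0 < n -> nth 1 (labels A B C Z (BD n)) n = B * A.
Proof.
move=> n_gt0; rewrite /= nth_cat size_map size_iota ifF; last by lia.
by have -> : n - n.-1 = 1%N by lia.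
Qed.

Lemma nth_labels_B (gT : finGroupType) (A B C Z : gT) n :
  0 < n -> nth 1 (labels A B C Z (BD n)) n.+1 = B.
Proof.
move=> n_gt0; rewrite /= nth_cat size_map size_iota ifF; last by lia.
by have -> : n.+1 - n.-1 = 2 by lia.
Qed.

(** Conjugation by B inverts A, so G is the disjoint union of <[A]> and
    B <[A]>; the class of A^i is {A^i, A^-i} and the elements B A^i form two
    classes according to the parity of i. Since (B A^i)^-1 = B A^(i+n), these
    two classes are real when n is even and mutually inverse when n is odd. *)
Lemma dihedral_mckay (gT : finGroupType) (G : {group gT}) (A B C Z : gT) n :
    1 < n -> #|G| = (4 * n)%N -> G :=: <<[set A; B]>> -> Z * Z = 1 ->
    A ^+ n = Z -> B ^+ 2 = Z -> (A * B) ^+ 2 = Z ->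
  mckay_data G A B C Z (BD n).
Proof.
move=> n_gt1 oG genG ZZ1 An BB AB2.
have A2n : A ^+ (2 * n) = 1 by rewrite mul2n -addnn expgD An.
have ABA : A * B * A = B.
  by apply: (mulIg B); rewrite -[RHS]/(B ^+ 2) BB -AB2 expgS expg1 !mulgA.
have AJB : A ^ B = A^-1.
  rewrite conjgE; apply: (mulgI B); rewrite mulKVg; apply: (mulIg A).
  by rewrite ABA mulgKV.
have invA i : i <= 2 * n -> (A ^+ i)^-1 = A ^+ (2 * n - i).
  by move=> le_i; apply/eqP; rewrite eq_invg_mul -expgD subnKC // A2n.
have AB i : A ^+ i * B = B * (A ^+ i)^-1 by rewrite conjgC conjXg AJB expVgn.
have GA : A \in G by rewrite genG mem_gen ?inE ?eqxx.
have GB : B \in G by rewrite genG mem_gen ?inE ?eqxx ?orbT.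
have A1 : A \in <[A]> by exact: cycle_id.
have AX i : A ^+ i \in <[A]> by exact: mem_cycle.
have G_sub : G \subset <[A]> :|: B *: <[A]>.
  rewrite genG; apply: gen_subset_closed; first by rewrite inE group1.
  move=> x y; rewrite !inE.
  case/orP=> [/cycleP[i ->]|/lcosetP[_ /cycleP[i ->] ->]] /orP[] /eqP->.
  - by rewrite -expgSr AX.
  - by rewrite AB -[_ * _]/(B * _) mem_lcoset mulKg groupV AX orbT.
  - by rewrite -mulgA -expgSr mem_lcoset mulKg AX orbT.
  - by rewrite -mulgA AB mulgA -[B * B]/(B ^+ 2) BB -An groupM ?groupV ?AX.
(* 4n = #|G| <= 2 #[A] <= 4n, so the two cosets are disjoint and #[A] = 2n. *)
have oA : #[A] = (2 * n)%N.
  have : #[A] <= 2 * n by rewrite dvdn_leq ?order_dvdn ?A2n //; lia.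
  have := subset_leq_card G_sub; have := (leq_card_setU <[A]> (B *: <[A]>)).1.
  rewrite card_lcoset oG -orderE; lia.
have AnB : B \notin <[A]>.
  apply/negP => AB'; have : G \subset <[A]>.
    by rewrite genG gen_subG subUset !sub1set A1.
  by move/subset_leq_card; rewrite oG -orderE oA; lia.
have cosetB i : B * A ^+ i \notin <[A]> by rewrite groupMr.
have expA_eq i j : (A ^+ i == A ^+ j) = (i == j %[mod 2 * n]).
  by rewrite eq_expg_mod_order oA.
have elts x : x \in G -> exists2 i, i < 2 * n & x = A ^+ i \/ x = B * A ^+ i.
  move/(subsetP G_sub); rewrite inE => /orP[/cyclePmin|/lcosetP[y /cyclePmin yA ->]].
    by rewrite oA => -[i lti ->]; exists i => //; left.
  by case: yA; rewrite oA => i lti ->; exists i => //; right.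
(* In class_A and class_B negative exponents are avoided: A^-i is written
   A^(2n-i), and 2n - i has the parity of i. *)
have class_A i x : i <= 2 * n ->
    reflect (x = A ^+ i \/ x = A ^+ (2 * n - i)) (x \in A ^+ i ^: G).
  move=> le_i; apply: (iffP imsetP) => [[g /elts[j lt_j [] ->] ->]|[]->].
  - by left; rewrite conjgE -!expgD addnC expgD mulKg.
  - right; rewrite conjgM conjXg AJB expVgn invA //.
    by rewrite conjgE -!expgD addnC expgD mulKg.
  - by exists 1; rewrite ?conjg1.
  - by exists B; rewrite // conjXg AJB expVgn invA.
have BJA i k : (B * A ^+ i) ^ (A ^+ k) = B * A ^+ (k + k + i).
  have BA : (A ^+ k)^-1 * B = B * A ^+ k.
    by apply: (mulgI (A ^+ k)); rewrite mulKVg mulgA AB mulgKV.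
  by rewrite conjgE !mulgA BA -!mulgA -!expgD -addnA [(i + k)%N]addnC.
have class_B i x : i <= 1 ->
    reflect (exists2 j, odd j = odd i & x = B * A ^+ j) (x \in (B * A ^+ i) ^: G).
  move=> le_i; apply: (iffP imsetP) => [[g /elts[k lt_k [] ->] ->]|[j odd_j ->]].
  - by rewrite BJA; exists (k + k + i)%N => //; lia.
  - exists (k + k + (2 * n - i))%N; first by lia.
    by rewrite conjgM -BJA; congr (_ ^ _); rewrite conjgE -mulgA mulKg AB invA //; lia.
  - exists (A ^+ j./2); first by rewrite groupX.
    by rewrite BJA; congr (B * A ^+ _); lia.
have lE i : i < n -> nth 1 (labels A B C Z (BD n)) i = A ^+ i.+1.
  move=> lt_in; rewrite /= nth_cat size_map size_iota.
  case: ltnP => [lt_i|le_i]; first by rewrite nth_powers.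
  by have -> : i = n.-1 by [lia]; rewrite subnn /= prednK ?An //; lia.
have lB : nth 1 (labels A B C Z (BD n)) n.+1 = B * A ^+ 0.
  by rewrite nth_labels_B ?mulg1 // ltnW.
have lBA : nth 1 (labels A B C Z (BD n)) n = B * A ^+ 1.
  by rewrite nth_labels_BA // ltnW.
have lP i : i < n.+2 -> [\/ i < n, i = n | i = n.+1].
  move=> lti; case: (ltngtP i n) => ?; [constructor 1|constructor 3|constructor 2] => //.
  by lia.
apply: mckay_data_labels => [i|i j|x Gx ntx|i]; rewrite /rank.
- move=> lti; have [lt_in|->|->] := lP _ lti; rewrite ?lB ?lBA ?lE //.
  + by rewrite -(expg0 A) expA_eq mod0n modn_small ?groupX //; lia.
  + by rewrite groupM ?groupX //; split=> //; apply: contraNneq (cosetB 1%N) => ->.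
  + by rewrite groupM ?groupX //; split=> //; apply: contraNneq (cosetB 0%N) => ->.
- move=> lti ltj.
  have [lt_in|->|->] := lP _ lti; have [lt_jn|->|->] := lP _ ltj; rewrite ?lB ?lBA ?lE //.
  + by case/class_A; [lia| |] => /eqP; rewrite expA_eq !modn_small; lia.
  + by case/class_B=> // k _ eq_k; case/negP: (cosetB k); rewrite -eq_k.
  + by case/class_B=> // k _ eq_k; case/negP: (cosetB k); rewrite -eq_k.
  + by case/class_A; [lia| |] => eq_k; case/negP: (cosetB 1%N); rewrite eq_k.
  + case/class_B=> // k odd_k /mulgI/eqP; rewrite expA_eq; lia.
  + by case/class_A; [lia| |] => eq_k; case/negP: (cosetB 0%N); rewrite eq_k.
  + case/class_B=> // k odd_k /mulgI/eqP; rewrite expA_eq; lia.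
- have [i lt_i [] def_x] := elts x Gx; rewrite {x}def_x in Gx ntx *.
    have i0 : i != 0%N by apply: contraNneq ntx => ->.
    have [le_in|lt_ni] := leqP i n.
      exists i.-1; first by lia.
      by rewrite lE ?prednK ?class_refl; lia.
    exists (2 * n - i).-1; first by lia.
    rewrite lE ?prednK; try lia.
    by apply/class_A; [lia|right; congr (_ ^+ _); lia].
  case odd_i: (odd i).
    by exists n => //; rewrite lBA; apply/class_B => //; exists i.
  by exists n.+1 => //; rewrite lB; apply/class_B => //; exists i.
- have invB : B^-1 = B * A ^+ n.
    by apply/eqP; rewrite eq_invg_mul mulgA -[B * B]/(B ^+ 2) BB An ZZ1.
  have invBA k : k <= 2 * n -> (B * A ^+ k)^-1 = B * A ^+ (k + n).
    move=> le_k; rewrite invMg invB mulgA invA // AB invA ?leq_subr // subKn //.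
    by rewrite -mulgA -expgD.
  move=> lti; rewrite /tau_nat; case: ifP => n_odd; last first.
    have [lt_in|->|->] := lP _ lti; rewrite ?lB ?lBA ?lE //.
    - by apply/class_A; [lia|right; rewrite invA //; lia].
    - by apply/class_B => //; exists (1 + n)%N; [lia|rewrite invBA //; lia].
    - by apply/class_B => //; exists (0 + n)%N; [lia|rewrite invBA //; lia].
  have [lt_in|->|->] := lP _ lti.
  - rewrite !ifF ?lE //; try lia.
    by apply/class_A; [lia|right; rewrite invA //; lia].
  - rewrite eqxx lBA lB; apply/class_B => //.
    by exists (1 + n)%N; [lia|rewrite invBA //; lia].
  - rewrite ifF ?eqxx ?lBA ?lB; last by lia.
    by apply/class_B => //; exists (0 + n)%N; [lia|rewrite invBA //; lia].
Qed.

(** * Computing with words in two generators *)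

Section WordModel.

Variables (gT : finGroupType) (G : {group gT}) (A B C Z : gT).

(** Words in A and B: the letter true stands for A and false for B. *)
Definition word_eval (w : seq bool) : gT := \prod_(x <- w) (if x then A else B).

Lemma word_eval_cat w1 w2 :
  word_eval (w1 ++ w2) = word_eval w1 * word_eval w2.
Proof. exact: big_cat. Qed.

Lemma word_eval_rcons w x :
  word_eval (rcons w x) = word_eval w * (if x then A else B).
Proof. by rewrite -cats1 word_eval_cat /word_eval big_seq1. Qed.

Lemma word_eval_nseq n x : word_eval (nseq n x) = (if x then A else B) ^+ n.
Proof.
by elim: n => [|n IHn]; rewrite /word_eval ?big_nil //= big_cons expgS -IHn.
Qed.

(** A word for the inverse, when A^(2p) = 1 and B^6 = 1: reverse the word and
    replace A by A^(2p-1) and B by B^5. *)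
Definition word_inv (p : nat) (w : seq bool) : seq bool :=
  flatten [seq nseq (if x then (2 * p).-1 else 5) x | x <- rev w].

(** A word for the conjugate of l by w. *)
Definition word_conj p (l w : seq bool) := word_inv p w ++ l ++ w.

Variables (p : nat).
Hypotheses (p_gt0 : 0 < p) (genG : G :=: <<[set A; B]>>)
  (A2p : A ^+ (2 * p) = 1) (B6 : B ^+ 6 = 1).

Lemma word_eval_inv w : word_eval (word_inv p w) = (word_eval w)^-1.
Proof.
elim: w => [|x w IHw]; first by rewrite /word_eval big_nil invg1.
rewrite /word_inv rev_cons map_rcons flatten_rcons word_eval_cat -/(word_inv p w).
rewrite IHw word_eval_nseq {2}/word_eval big_cons invMg; congr (_ * _).
by apply/esym/eqP; case: x; rewrite eq_invg_mul -expgS ?prednK ?A2p ?B6 // muln_gt0.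
Qed.

Lemma word_eval_conj l w : word_eval (word_conj p l w) = word_eval l ^ word_eval w.
Proof. by rewrite !word_eval_cat word_eval_inv conjgE. Qed.

Lemma word_eval_in w : word_eval w \in G.
Proof.
apply: group_prod => -[] _; rewrite genG mem_gen // !inE eqxx ?orbT //.
Qed.

(** An assignment nf of normal forms to words, compatible with appending a
    letter and sound: words with the same normal form have the same value. *)
Variables (T : eqType) (nf : seq bool -> T) (ws : seq (seq bool)).
Hypothesis (nf_sound : forall v w, nf v = nf w -> word_eval v = word_eval w)
  (nf_rcons : forall x v w, nf v = nf w -> nf (rcons v x) = nf (rcons w x)).

(** The N words of ws have, up to normal form, the empty word among them and are
    closed under appending a letter. *)
Definition complete_words (N : nat) :=
  let nfs := map nf ws in
  [&& nf [::] \in nfs,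
      all (fun w => (nf (rcons w true) \in nfs) && (nf (rcons w false) \in nfs)) ws
    & size ws == N].

Hypothesis (ws_complete : complete_words #|G|).

Lemma word_surj x : x \in G -> exists2 w, w \in ws & x = word_eval w.
Proof.
case/and3P: ws_complete => nf1 /allP nfM _ Gx.
suff /subsetP/(_ x Gx) : G \subset [set x in map word_eval ws].
  by rewrite inE => /mapP.
rewrite genG; apply: gen_subset_closed => [|y z].
  case/mapP: nf1 => w ws_w /nf_sound eq_w; rewrite inE; apply/mapP; exists w => //.
  by rewrite -eq_w /word_eval big_nil.
have mem_rcons w b : w \in ws -> word_eval (rcons w b) \in map word_eval ws.
  move=> /nfM/andP[nfA nfB]; have /mapP[w' ws_w' /nf_sound ->] : nf (rcons w b) \in map nf ws.
    by case: b.
  exact: map_f.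
rewrite !inE => /mapP[w ws_w ->] /orP[]/eqP->.
  by rewrite -(word_eval_rcons w true) mem_rcons.
by rewrite -(word_eval_rcons w false) mem_rcons.
Qed.

(** By [word_surj] the words of ws represent all of G; as there are only #|G| of
    them, each element is represented once. *)
Lemma word_eval_inj : {in ws &, injective word_eval}.
Proof.
case/and3P: ws_complete => _ _ /eqP size_ws.
have uniq_ws : uniq (map word_eval ws).
  apply: (@leq_size_uniq _ (enum G)); first exact: enum_uniq.
    by move=> x; rewrite mem_enum => /word_surj[w ws_w ->]; apply: map_f.
  by rewrite size_map size_ws -cardE.
move=> v w ws_v ws_w eq_vw; rewrite -(nth_index [::] ws_v) -(nth_index [::] ws_w).
congr (nth _ _ _); apply/eqP; rewrite -(nth_uniq 1 _ _ uniq_ws) ?size_map ?index_mem //.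
by rewrite !(nth_map [::]) ?index_mem // !nth_index ?eq_vw.
Qed.

Lemma word_mem_nf w : nf w \in map nf ws.
Proof.
case/and3P: ws_complete => nf1 /allP nfM _.
elim/last_ind: w => [//|w x /mapP[w' /nfM/andP[nfA nfB] /(nf_rcons x)->]].
by case: x.
Qed.

(** Completeness of normal forms, which makes equality and conjugacy in G
    decidable by computing with words. *)
Lemma word_eval_nf v w : word_eval v = word_eval w -> nf v = nf w.
Proof.
have /mapP[v' ws_v nf_v] := word_mem_nf v; have /mapP[w' ws_w nf_w] := word_mem_nf w.
rewrite (nf_sound nf_v) (nf_sound nf_w) nf_v nf_w => eq_vw.
by rewrite (word_eval_inj ws_v ws_w eq_vw).
Qed.

(** The hypotheses of [mckay_data_labels] expressed by normal forms: for the r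
    words ls, cls lists the normal forms of all conjugates of each of them. *)
Definition check_labels (r : nat) (sigma : nat -> nat) (ls : seq (seq bool)) :=
  let cls := [seq [seq nf (word_conj p l w) | w <- ws] | l <- ls] in
  [&& all (fun i => nf (nth [::] ls i) != nf [::]) (iota 0 r),
      all (fun i => all (fun j =>
        (nf (nth [::] ls i) \in nth [::] cls j) ==> (i == j)) (iota 0 r)) (iota 0 r),
      all (fun w => (nf w == nf [::]) ||
        has (fun i => nf w \in nth [::] cls i) (iota 0 r)) ws
    & all (fun i => nf (word_inv p (nth [::] ls i)) \in nth [::] cls (sigma i))
        (iota 0 r)].

Lemma word_mckay t (ls : seq (seq bool)) :
    labels A B C Z t = map word_eval ls -> size ls = rank t ->
    check_labels (rank t) (tau_nat t) ls ->
  mckay_data G A B C Z t.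
Proof.
move=> def_l size_ls /and4P[/allP l_nt /allP l_inj /allP l_surj /allP l_inv].
set l := fun i => nth [::] ls i.
have lE i : i < rank t -> nth 1 (labels A B C Z t) i = word_eval (l i).
  by move=> lt_i; rewrite def_l (nth_map [::]) ?size_ls.
have ltI i : (i \in iota 0 (rank t)) = (i < rank t) by rewrite mem_iota.
have clP i v : i < rank t -> reflect (word_eval v \in word_eval (l i) ^: G)
   (nf v \in nth [::] [seq [seq nf (word_conj p l w) | w <- ws] | l <- ls] i).
  move=> lt_i; rewrite (nth_map [::]) ?size_ls //.
  apply: (iffP mapP) => [[w ws_w /nf_sound->]|/imsetP[x /word_surj[w ws_w ->]]].
    by rewrite word_eval_conj memJ_class ?word_eval_in.
  by rewrite -word_eval_conj => /word_eval_nf nf_eq; exists w.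
have word1 : word_eval [::] = 1 by rewrite /word_eval big_nil.
apply: mckay_data_labels => [i lti|i j lti ltj|x Gx ntx|i lti].
- rewrite lE // word_eval_in; split=> //.
  have := l_nt i; rewrite ltI => /(_ lti); apply: contraNneq.
  by rewrite -word1 => /word_eval_nf/eqP.
- rewrite !lE // => /(clP _ _ ltj) l_ij.
  have := l_inj i; rewrite ltI => /(_ lti)/allP/(_ j); rewrite ltI => /(_ ltj).
  by rewrite l_ij => /eqP.
- have [w ws_w def_x] := word_surj Gx.
  case/orP: (l_surj w ws_w) => [/eqP/nf_sound|/hasP[i ]].
    by rewrite -def_x word1 => /eqP; rewrite (negPf ntx).
  rewrite ltI => lti /(clP _ _ lti) w_i; exists i => //.
  by rewrite lE // def_x.
- have lt_tau := tau_nat_lt lti.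
  rewrite !lE // -word_eval_inv; apply/clP => //.
  by have := l_inv i; rewrite ltI => /(_ lti).
Qed.

End WordModel.

(** * Matrices of determinant one and the quaternion algebra *)

Section QuaternionModel.

Local Open Scope ring_scope.
Import GRing.Theory.

(** Elements x.1 + x.2 w of Z[w], where w^2 = u w + v; s is the trace of A. *)
Definition coef : Type := int * int.

Variables (u v : int) (s : coef).

Definition coef_add (x y : coef) : coef := (x.1 + y.1, x.2 + y.2).
Definition coef_opp (x : coef) : coef := (- x.1, - x.2).
(** Multiplication by s. *)
Definition coef_smul (x : coef) : coef :=
  (s.1 * x.1 + s.2 * x.2 * v, s.1 * x.2 + s.2 * x.1 + s.2 * x.2 * u).

(** (a, b, c, d) stands for a + b A + c B + d AB. *)
Definition quad : Type := coef * coef * coef * coef.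

(** Right multiplication by A (letter true) or B (letter false), from
    A^2 = s A - 1, B^2 = B - 1, BA = A + s B - AB - s and ABA = B - 1. *)
Definition quad_step (q : quad) (x : bool) : quad :=
  let: (a, b, c, d) := q in
  if x then (coef_opp (coef_add (coef_add b (coef_smul c)) d),
             coef_add (coef_add a (coef_smul b)) c,
             coef_add (coef_smul c) d, coef_opp c)
  else (coef_opp c, coef_opp d, coef_add a c, coef_add b d).

(** The normal form of a word, starting from that of 1. *)
Definition quad_word (w : seq bool) : quad :=
  foldl quad_step ((1, 0), (0, 0), (0, 0), (0, 0)) w.

Lemma quad_word_rcons x w1 w2 :
  quad_word w1 = quad_word w2 -> quad_word (rcons w1 x) = quad_word (rcons w2 x).
Proof. by rewrite /quad_word -!cats1 !foldl_cat => ->. Qed.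

Variables (F : fieldType) (w t : F) (MA MB : 'M[F]_2).

(** The values in F and in the matrices over F of coefficients and quadruples. *)
Definition coef_eval (x : coef) : F := x.1%:~R + x.2%:~R * w.

Definition quad_eval (q : quad) : 'M[F]_2 :=
  let: (a, b, c, d) := q in
  coef_eval a *: 1 + coef_eval b *: MA + coef_eval c *: MB
    + coef_eval d *: (MA * MB).

Hypotheses (w2 : w * w = u%:~R * w + v%:~R) (sE : t = coef_eval s)
  (MA2 : MA * MA = t *: MA - 1) (MB2 : MB * MB = MB - 1)
  (MAB2 : MA * MB * (MA * MB) = - 1).

Lemma coef_eval_add x y : coef_eval (coef_add x y) = coef_eval x + coef_eval y.
Proof. rewrite /coef_eval /= !rmorphD /=; ring. Qed.

Lemma coef_eval_opp x : coef_eval (coef_opp x) = - coef_eval x.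
Proof. rewrite /coef_eval /= !rmorphN /=; ring. Qed.

Lemma coef_eval_smul x : coef_eval (coef_smul x) = t * coef_eval x.
Proof.
rewrite sE /coef_eval /= !rmorphD !rmorphM /=; ring: w2.
Qed.

(** From (AB)^2 = -1, BA = - A^-1 B^-1 with A^-1 = t - A and B^-1 = 1 - B;
    here A and B are MA and MB. *)
Lemma mulBA : MB * MA = t *: MB + MA - MA * MB - t *: 1.
Proof.
have invA : (t *: 1 - MA) * MA = 1.
  by rewrite mulrBl MA2 -scalerAl mul1r opprB addrC subrK.
have invB : MB * (1 - MB) = 1 by rewrite mulrBr MB2 mulr1 opprB addrC subrK.
have : (t *: 1 - MA) * (MA * MB * (MA * MB)) * (1 - MB) = MB * MA.
  by rewrite !mulrA invA mul1r -!mulrA invB mulr1.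
rewrite MAB2 => <-.
rewrite mulrN1 mulNr mulrBl mulrBr mulr1 mulrBr mulr1 -scalerAl mul1r.
by apply/matrixP => i j; rewrite !mxE; ring.
Qed.

Lemma quad_eval_step q x :
  quad_eval (quad_step q x) = quad_eval q * (if x then MA else MB).
Proof.
have MABA : MA * MB * MA = MB - 1.
  rewrite -mulrA mulBA !mulrBr mulrDr -!scalerAr mulr1 mulrA MA2 mulrBl -scalerAl mul1r.
  by apply/matrixP => i j; rewrite !mxE; ring.
case: q => [[[a b] c] d]; case: x; rewrite /quad_eval /quad_step;
  rewrite !(coef_eval_add, coef_eval_opp, coef_eval_smul) !mulrDl -!scalerAl mul1r.
  rewrite MABA mulBA MA2; apply/matrixP=> i j; rewrite !mxE; ring.
rewrite -mulrA MB2 mulrBr mulr1; apply/matrixP=> i j; rewrite !mxE; ring.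
Qed.

End QuaternionModel.

Section Trace.

Local Open Scope ring_scope.
Import GRing.Theory.

Variable F : fieldType.
Implicit Type M : 'M[F]_2.

Lemma mx2_Cayley_Hamilton M : M * M = \tr M *: M - (\det M)%:M.
Proof.
have ord2P (i : 'I_2) : i = ord0 \/ i = lift ord0 ord0.
  by case: i => -[|[|//]] lt_i; [left | right]; apply: val_inj.
rewrite (expand_det_row _ ord0) !big_ord_recl big_ord0 /cofactor !det_mx11 /mxtrace.
rewrite !big_ord_recl big_ord0.
apply/matrixP => i j; rewrite !mxE !big_ord_recl big_ord0.
have l1 : lift (lift ord0 ord0) ord0 = ord0 :> 'I_2 by apply: val_inj.
by case: (ord2P i) => ->; case: (ord2P j) => ->; rewrite /= !l1; ring.
Qed.

(** M and 1 are linearly independent. *)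
Definition nonscalar M := forall a b : F, a *: M = b *: 1 -> a = 0 /\ b = 0.

Lemma nonscalar_det1 M :
  \det M = 1 -> M != 1 -> M != - 1 -> nonscalar M.
Proof.
move=> detM M1 MN1 a b eq_ab; have [a0|a_neq0] := eqVneq a 0.
  split=> //; move/matrixP: eq_ab => /(_ ord0 ord0).
  by rewrite a0 !mxE mul0r /= mulr1.
have defM : M = (b / a)%:M.
  by rewrite -[M]scale1r -(mulVf a_neq0) -scalerA eq_ab scalerA scalemx1 mulrC.
move: detM; rewrite defM det_scalar => /eqP; rewrite sqrf_eq1.
case/orP=> /eqP ba; first by rewrite defM ba eqxx in M1.
by rewrite defM ba -scalemx1 scaleN1r eqxx in MN1.
Qed.

(** The Cayley-Hamilton recurrence for powers of a matrix of determinant 1. *)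
Lemma mx2_expr M a b n : \det M = 1 -> M ^+ n = a *: M + b *: 1 ->
  M ^+ n.+1 = (a * \tr M + b) *: M + (- a) *: 1.
Proof.
move=> detM; rewrite exprS => ->; rewrite mulrDr -!scalerAr mulr1.
rewrite mx2_Cayley_Hamilton detM.
by apply/matrixP => i j; rewrite !mxE; ring.
Qed.

Lemma nonscalar_root_N1 M a b n : nonscalar M ->
  M ^+ n = a *: M + b *: 1 -> M ^+ n = - 1 -> a = 0 /\ b = - 1.
Proof.
move=> nsM -> eq_N1; have [|a0 b1] := nsM a (- 1 - b); last split=> //.
  by rewrite scalerBl scaleN1r -eq_N1 addrK.
by apply/eqP; rewrite -subr_eq0 -oppr_eq0 opprB b1.
Qed.

Section Roots.

Variable M : 'M[F]_2.
Hypotheses (nsM : nonscalar M) (detM : \det M = 1).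
Let t := \tr M.

Let M1 : M ^+ 1 = 1 *: M + 0 *: 1.
Proof. by rewrite expr1 scale1r scale0r addr0. Qed.
Let M3 := mx2_expr detM (mx2_expr detM M1).
Let M4 := mx2_expr detM M3.
Let M5 := mx2_expr detM M4.

Lemma trace_root3_N1 : M ^+ 3 = - 1 -> t = 1.
Proof. by case/(nonscalar_root_N1 nsM M3) => _ /oppr_inj; rewrite mul1r addr0. Qed.

Lemma trace_root4_N1 : M ^+ 4 = - 1 -> t * t = 2%:R.
Proof.
case/(nonscalar_root_N1 nsM M4) => _; rewrite -/t => tE.
by transitivity (1 - (- ((1 * t + 0) * t - 1))); [ring | rewrite tE; ring].
Qed.

(** The coefficients of M^5 = -1 give (t + 1) (t^2 - t - 1) = 0 and
    t^4 - 3 t^2 + 1 = 0; the latter excludes t = -1. *)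
Lemma trace_root5_N1 : M ^+ 5 = - 1 -> t * t = t + 1.
Proof.
case/(nonscalar_root_N1 nsM M5); rewrite -/t => a0 b1.
have : (t + 1) * (t * t - t - 1) = 0.
  transitivity (- (- (((1 * t + 0) * t - 1) * t - (1 * t + 0))) - 1); first by ring.
  by rewrite b1; ring.
move/eqP; rewrite mulf_eq0 => /orP[/eqP t1|/eqP tt].
  have tE : t = -1 by rewrite -[t](addrK 1) t1 sub0r.
  have : (1 : F) = 0.
    by rewrite -[RHS]oppr0 -[in RHS]a0 tE; ring.
  by move/eqP; rewrite oner_eq0.
by rewrite -[LHS]subr0 -tt; ring.
Qed.

End Roots.

End Trace.

(** * The binary polyhedral groups *)

(** Breadth-first enumeration of words with distinct normal forms: k rounds, each
    appending a letter to the words found so far. *)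
Fixpoint span_words (T : eqType) (nf : seq bool -> T) (k : nat) (ws : seq (seq bool)) :=
  if k is k'.+1 then
    span_words nf k'
      (foldl (fun acc w => if nf w \in map nf acc then acc else rcons acc w) ws
         [seq rcons w x | w <- ws, x <- [:: true; false]])
  else ws.

(** The whole computation for the group with parameters p, N = #|G|, with the
    quaternion coefficients given by u, v, s; k is the number of rounds of the
    enumeration and ls the list of labels as words. *)
Definition polyhedral_check (u v : int) s p N k (t : ade) (ls : seq (seq bool)) :=
  let nf := quad_word u v s in
  let ws := span_words nf k [:: [::]] in
  complete_words nf ws N && check_labels p nf ws (rank t) (tau_nat t) ls.

Section BinaryPolyhedral.

Variables (F : fieldType) (gT : finGroupType) (G : {group gT}).
Variable rG : mx_representation F G 2.
Hypotheses (rG_faithful : mx_faithful rG)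
  (rG_SL2 : forall x, x \in G -> (\det (rG x) = 1)%R).

Lemma central_involution Z : Z \in G -> rG Z = (- 1%:M)%R -> Z * Z = 1.
Proof.
move=> GZ rZ; apply: (mx_faithful_inj rG_faithful); rewrite ?groupM //.
by rewrite repr_mxM // rZ repr_mx1 mulmxN mulmx1 GRing.opprK.
Qed.

(** A scalar matrix of determinant 1 is 1 or -1. *)
Lemma nonscalar_repr Z x : Z \in G -> rG Z = (- 1%:M)%R ->
  x \in G -> x != 1 -> x != Z -> nonscalar (rG x).
Proof.
move=> GZ rZ Gx x1 xZ; apply: nonscalar_det1; first exact: rG_SL2.
  apply: contraNneq x1 => rx1; apply/eqP/(mx_faithful_inj rG_faithful) => //.
  by rewrite rx1 repr_mx1.
apply: contraNneq xZ => rxZ; apply/eqP/(mx_faithful_inj rG_faithful) => //.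
by rewrite rxZ rZ.
Qed.

Variables (A B C Z : gT) (p : nat).
Hypotheses (p_gt0 : 0 < p) (lt_pG : 2 * p < #|G|) (lt_6G : 6 < #|G|)
  (genG : G :=: <<[set A; B; C]>>) (GZ : Z \in G) (rZ : rG Z = (- 1%:M)%R)
  (Ap : A ^+ p = Z) (B3 : B ^+ 3 = Z) (C2 : C ^+ 2 = Z) (ABC : A * B * C = Z).

Let ZZ : Z * Z = 1. Proof. exact: central_involution. Qed.

Lemma polyhedral_C : C = A * B.
Proof. by apply: (mulIg C); rewrite ABC -C2. Qed.

Lemma polyhedral_gen : G :=: <<[set A; B]>>.
Proof.
rewrite genG; apply/eqP; rewrite eqEsubset !gen_subG !subUset !sub1set.
by rewrite polyhedral_C groupM !mem_gen // !inE eqxx ?orbT.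
Qed.

Let GA : A \in G. Proof. by rewrite genG mem_gen ?inE ?eqxx. Qed.
Let GB : B \in G. Proof. by rewrite genG mem_gen ?inE ?eqxx ?orbT. Qed.

Lemma polyhedral_A : A ^+ (2 * p) = 1.
Proof. by rewrite mul2n -addnn expgD Ap. Qed.

Lemma polyhedral_B : B ^+ 6 = 1.
Proof. by rewrite -[6]/(3 + 3)%N expgD B3. Qed.

Lemma polyhedral_noncyclic x n : 0 < n < #|G| -> x ^+ n = 1 -> ~~ (G \subset <[x]>).
Proof.
case/andP=> n_gt0 lt_nG xn; apply/negP => /subset_leq_card.
rewrite leqNgt; case/negP; apply: leq_ltn_trans lt_nG.
by apply: dvdn_leq; rewrite // order_dvdn xn.
Qed.

(** Were A equal to 1 or Z = B^3, the group would be generated by B, which has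
    order at most 6; similarly for B in [nonscalar_B]. *)
Lemma nonscalar_A : nonscalar (rG A).
Proof.
have G_B : ~~ (G \subset <[B]>).
  by apply: (@polyhedral_noncyclic B 6); rewrite ?polyhedral_B.
apply: (nonscalar_repr GZ rZ GA); apply: contraNneq G_B => A_eq.
  by rewrite polyhedral_gen gen_subG subUset !sub1set A_eq group1 cycle_id.
by rewrite polyhedral_gen gen_subG subUset !sub1set A_eq -B3 mem_cycle cycle_id.
Qed.

Lemma nonscalar_B : nonscalar (rG B).
Proof.
have G_A : ~~ (G \subset <[A]>).
  apply: (@polyhedral_noncyclic A (2 * p)); rewrite ?polyhedral_A //.
  by rewrite lt_pG muln_gt0 p_gt0.
apply: (nonscalar_repr GZ rZ GB); apply: contraNneq G_A => B_eq.
  by rewrite polyhedral_gen gen_subG subUset !sub1set B_eq group1 cycle_id.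
by rewrite polyhedral_gen gen_subG subUset !sub1set B_eq -Ap mem_cycle cycle_id.
Qed.

Section WordRepresentation.

Variables (u v : int) (s : coef) (w : F).
Hypotheses (w2 : (w * w = u%:~R * w + v%:~R)%R)
  (trA : (\tr (rG A) = coef_eval w s)%R).

(** The quaternion normal form of a word computes its matrix. *)
Lemma repr_word_eval ws :
  rG (word_eval A B ws) = quad_eval w (rG A) (rG B) (quad_word u v s ws).
Proof.
have A2 : (rG A * rG A = \tr (rG A) *: rG A - 1)%R.
  by rewrite mx2_Cayley_Hamilton rG_SL2.
have B2 : (rG B * rG B = rG B - 1)%R.
  rewrite mx2_Cayley_Hamilton rG_SL2 // trace_root3_N1 ?GRing.scale1r ?rG_SL2 //.
    exact: nonscalar_B.
  by rewrite -repr_mxX // B3 rZ.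
have AB2 : (rG A * rG B * (rG A * rG B) = - 1)%R.
  rewrite -[(rG A * rG B)%R]/(rG A *m rG B)%R -repr_mxM // -polyhedral_C.
  rewrite -[LHS]/(rG C *m rG C)%R -repr_mxM //; last first.
    by rewrite polyhedral_C groupM.
    by rewrite polyhedral_C groupM.
  by rewrite -[C * C]/(C ^+ 2) C2 rZ.
elim/last_ind: ws => [|ws x IHws].
  rewrite /word_eval big_nil repr_mx1 /quad_eval /coef_eval /=.
  by rewrite !GRing.mul0r !GRing.addr0 !GRing.scale0r !GRing.addr0 GRing.scale1r.
rewrite word_eval_rcons repr_mxM ?IHws ?(word_eval_in polyhedral_gen) //; last by case: x.
rewrite /quad_word -cats1 foldl_cat /= -/(quad_word u v s ws).
by rewrite (quad_eval_step w2 trA A2 B2 AB2); case: x.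
Qed.

Lemma quad_word_sound v1 v2 : quad_word u v s v1 = quad_word u v s v2 ->
  word_eval A B v1 = word_eval A B v2.
Proof.
move=> eq_v; apply: (mx_faithful_inj rG_faithful);
  rewrite ?(word_eval_in polyhedral_gen) //.
by rewrite !repr_word_eval eq_v.
Qed.

End WordRepresentation.

(** The conclusion for a polyhedral type, once the trace of A is known to be a
    suitable element of Z[w] and the computation with words succeeds. *)
Lemma polyhedral_mckay N u v s k t ls :
    #|G| = N ->
    (forall M : 'M[F]_2, nonscalar M -> (\det M = 1)%R -> (M ^+ p = - 1)%R ->
      exists2 w, (w * w = u%:~R * w + v%:~R)%R & (\tr M = coef_eval w s)%R) ->
    labels A B C Z t = map (word_eval A B) ls -> size ls = rank t ->
    polyhedral_check u v s p N k t ls ->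
  mckay_data G A B C Z t.
Proof.
move=> <- trace def_l size_ls /andP[complete check].
have [||w w2 trA] := trace (rG A) nonscalar_A; first exact: rG_SL2.
  by rewrite -repr_mxX // Ap rZ.
apply: word_mckay complete _ _ def_l size_ls check => //.
- exact: polyhedral_gen.
- exact: polyhedral_A.
- exact: polyhedral_B.
- exact: quad_word_sound w2 trA.
- exact: quad_word_rcons.
Qed.

End BinaryPolyhedral.

(** The labels of the vertices as words, using Z = B^3 and C = AB. *)
Local Notation a := true.
Local Notation b := false.

Definition BT_words :=
  [:: [:: b]; [:: b; b]; [:: b; b; b]; [:: a; a]; [:: a]; [:: a; b]].

Definition BO_words :=
  [:: [:: b]; [:: b; b]; [:: b; b; b];
      [:: a; a; a]; [:: a; a]; [:: a]; [:: a; b]].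

Definition BI_words :=
  [:: [:: b]; [:: b; b]; [:: b; b; b];
      [:: a; a; a; a]; [:: a; a; a]; [:: a; a]; [:: a]; [:: a; b]].

Lemma BT_check : polyhedral_check 0 1 (1, 0)%R 3 24 6 BT BT_words.
Proof. by vm_compute. Qed.

Lemma BO_check : polyhedral_check 0 2 (0, 1)%R 4 48 8 BO BO_words.
Proof. by vm_compute. Qed.

Lemma BI_check : polyhedral_check 1 1 (0, 1)%R 5 120 12 BI BI_words.
Proof. by vm_compute. Qed.

(** * Assembling the types *)

Lemma generators_mckay (F : fieldType) (gT : finGroupType) (G : {group gT})
    (rG : mx_representation F G 2) t (A B C Z : gT) :
    mx_faithful rG -> (forall x, x \in G -> (\det (rG x) = 1)%R) ->
    generators rG t A B C Z ->
  valid t /\ mckay_data G A B C Z t.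
Proof.
move=> rG_faithful rG_SL2; case: t => [n|n|||].
- by case=> n_gt0 oG genG An; split=> //; apply: cyclic_mckay.
- case=> n_gt1 oG genG [GZ rZ] [An B2 AB2]; split=> //.
  by apply: dihedral_mckay; rewrite ?(central_involution rG_faithful GZ rZ).
- case=> oG genG [GZ rZ] [Ap B3 C2 ABC]; split=> //.
  (* The trace of A is 1, so w plays no role; w = 1 satisfies w^2 = 1. *)
  apply: (polyhedral_mckay rG_faithful rG_SL2 _ _ _ genG GZ rZ Ap B3 C2 ABC
            oG _ _ _ BT_check); rewrite ?oG //.
  + move=> M nsM detM M_root; exists 1%R; first by rewrite GRing.mul0r GRing.mulr1 GRing.add0r.
    by rewrite /coef_eval (trace_root3_N1 nsM detM M_root) /= GRing.mul0r GRing.addr0.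
  + by rewrite /= -B3 (polyhedral_C C2 ABC) /word_eval !big_cons !big_nil !mulg1.
- case=> oG genG [GZ rZ] [Ap B3 C2 ABC]; split=> //.
  apply: (polyhedral_mckay rG_faithful rG_SL2 _ _ _ genG GZ rZ Ap B3 C2 ABC
            oG _ _ _ BO_check); rewrite ?oG //.
  + move=> M nsM detM M_root; exists (\tr M)%R.
      by rewrite (trace_root4_N1 nsM detM M_root) GRing.mul0r GRing.add0r.
    by rewrite /coef_eval /= GRing.mul1r GRing.add0r.
  + by rewrite /= -B3 (polyhedral_C C2 ABC) /word_eval !big_cons !big_nil !mulg1.
- case=> oG genG [GZ rZ] [Ap B3 C2 ABC]; split=> //.
  apply: (polyhedral_mckay rG_faithful rG_SL2 _ _ _ genG GZ rZ Ap B3 C2 ABC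
            oG _ _ _ BI_check); rewrite ?oG //.
  + move=> M nsM detM M_root; exists (\tr M)%R.
      by rewrite (trace_root5_N1 nsM detM M_root) GRing.mul1r.
    by rewrite /coef_eval /= GRing.mul1r GRing.add0r.
  + by rewrite /= -B3 (polyhedral_C C2 ABC) /word_eval !big_cons !big_nil !mulg1.
Qed.

Lemma classes_cxP (gT : finGroupType) (G : {group gT}) (A B C Z : gT) t c :
    mckay_data G A B C Z t ->
  reflect (exists2 i, (i < rank t) && (tau_nat t i != i)
                    & c = nth 1 (labels A B C Z t) i ^: G)
          (c \in classes_cx G).
Proof.
move=> data; rewrite -(classes_cxE data).
apply: (iffP imsetP) => [[i ]|[i /andP[lt_i taui] ->]].
  rewrite inE -val_eqE /= [X in X != _]val_tau_perm => taui ->.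
  by exists i; rewrite ?ltn_ord.
by exists (Ordinal lt_i); rewrite // inE -val_eqE /= [X in X != _]val_tau_perm.
Qed.

(** The number of vertices not fixed by tau. *)
Definition moved t := count (fun i => tau_nat t i != i) (iota 0 (rank t)).

Lemma mckay_cards (gT : finGroupType) (G : {group gT}) (A B C Z : gT) t :
    mckay_data G A B C Z t ->
  (#|classes G|, #|classes_cx G|, #|classes_re G|)
    = ((rank t).+1, moved t, rank t - moved t).
Proof.
move=> data; rewrite (card_classes data) (card_classes_cx data) (card_classes_re data).
rewrite card_tau_fixed card_tau_moved -/(moved t); congr (_, _, _).
apply/eqP; rewrite -(eqn_add2r (moved t)) subnK; last first.
  by rewrite -[X in _ <= X](size_iota 0) count_size.
by rewrite /moved count_predC size_iota.
Qed.

Lemma tau_perm_order1 t :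
  (forall i, i < rank t -> tau_nat t i = i) -> #[tau_perm t] = 1%N.
Proof.
move=> fix_tau; apply/eqP; rewrite order_eq1; apply/eqP/permP => i.
by apply: val_inj; rewrite perm1 [LHS]val_tau_perm fix_tau.
Qed.

Lemma tau_perm_order2 t i : i < rank t -> tau_nat t i != i -> #[tau_perm t] = 2.
Proof.
move=> lt_i taui; apply: nt_prime_order => //.
  by apply/permP => j; rewrite expgS expg1 permM perm1 tau_permK.
apply: contraNneq taui => tau1.
by rewrite -(val_tau_perm (Ordinal lt_i)) tau1 perm1.
Qed.

Lemma moved0 t : (forall i, i < rank t -> tau_nat t i = i) -> moved t = 0%N.
Proof.
move=> fix_tau; rewrite /moved (@eq_in_count _ _ pred0) ?count_pred0 // => i.
by rewrite mem_iota => /fix_tau->; rewrite eqxx.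
Qed.

Lemma moved_ZZ_odd k : moved (ZZ (2 * k + 1)) = (2 * k)%N.
Proof.
rewrite /moved (@eq_in_count _ _ predT) ?count_predT ?size_iota /=; first by lia.
by move=> i; rewrite mem_iota /=; lia.
Qed.

Lemma moved_ZZ_even k : 0 < k -> moved (ZZ (2 * k)) = (2 * k - 2)%N.
Proof.
move=> k_gt0; rewrite /moved (@eq_in_count _ _ (predC (pred1 k.-1))); last first.
  by move=> i; rewrite mem_iota /=; lia.
have := count_predC (pred1 k.-1) (iota 0 (rank (ZZ (2 * k)))).
by rewrite count_uniq_mem ?iota_uniq // mem_iota size_iota /=; lia.
Qed.

Lemma tau_nat_BD_even k i : i < rank (BD (2 * k)) -> tau_nat (BD (2 * k)) i = i.
Proof. by rewrite /tau_nat ifF //; lia. Qed.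

Lemma moved_BD_odd n : odd n -> moved (BD n) = 2.
Proof.
move=> n_odd; rewrite /moved /rank -addn2 iotaD count_cat.
rewrite (@eq_in_count _ _ pred0) ?count_pred0 => [|i]; last first.
  by rewrite mem_iota /= => lt_in; apply/eqP; lia_if.
have moved_end i : n <= i < n.+2 -> (tau_nat (BD n) i != i) = true.
  by rewrite /= n_odd => i_end; apply/eqP; lia_if.
by rewrite add0n [iota n 2]/= [count _ _]/= !moved_end //; lia.
Qed.

Theorem theorem3p19 (R : realType) (gT : finGroupType) (G : {group gT})
    (rG : mx_representation (complex R) G 2)
    (rG_faithful : mx_faithful rG)
    (rG_SL2 : forall x, x \in G -> (\det (rG x) = 1)%R)
    (t : ade) (A B C Z : gT)
    (gensG : generators rG t A B C Z) :
  exists tau : {perm 'I_(rank t)},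
    unique (@is_tau t) tau /\
    (* the dual McKay correspondence is a bijection *)
    (injective (@dual_mckay gT G A B C Z t) /\
     [set dual_mckay G A B C Z i | i : 'I_(rank t)]
       = classes G :\ [set 1]) /\
    (* (1) *)
    ([set dual_mckay G A B C Z i | i : 'I_(rank t) & tau i == i]
       = classes_re G /\
     [set dual_mckay G A B C Z i | i : 'I_(rank t) & tau i != i]
       = classes_cx G) /\
    (* (2) *)
    ((forall k, (0 < k)%N -> t = ZZ (2 * k + 1) ->
        classes_cx G =
          [set (A ^+ i) ^: G | i : 'I_(2 * k + 1) & (1 <= i)%N]) /\
     (forall k, t = ZZ (2 * k) ->
        classes_cx G =
          [set (A ^+ i) ^: G | i : 'I_(2 * k)
                             & (1 <= i)%N && (i != k :> nat)]) /\
     (forall k, (0 < k)%N -> t = BD (2 * k + 1) ->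
        classes_cx G = [set B ^: G; (B * A) ^: G]) /\
     (t = BT ->
        classes_cx G =
          [set A ^: G; B ^: G; (A ^+ 2) ^: G; (B ^+ 2) ^: G]) /\
     (forall k, t = BD (2 * k) -> classes_cx G = set0) /\
     (t = BO -> classes_cx G = set0) /\
     (t = BI -> classes_cx G = set0)) /\
    (* (3) *)
    (let cards :=
       (#|classes G|, #|classes_cx G|, #|classes_re G|, #[tau]) in
     (forall k, (0 < k)%N -> t = ZZ (2 * k + 1) ->
        cards = (2 * k + 1, 2 * k, 0, 2)%N) /\
     (t = ZZ 1 -> cards = (1, 0, 0, 1)%N) /\
     (forall k, (1 < k)%N -> t = ZZ (2 * k) ->
        cards = (2 * k, 2 * k - 2, 1, 2)%N) /\
     (t = ZZ 2 -> cards = (2, 0, 1, 1)%N) /\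
     (forall k, t = BD (2 * k) ->
        cards = (2 * k + 3, 0, 2 * k + 2, 1)%N) /\
     (forall k, t = BD (2 * k + 1) ->
        cards = (2 * k + 4, 2, 2 * k + 1, 2)%N) /\
     (t = BT -> cards = (7, 4, 2, 2)%N) /\
     (t = BO -> cards = (8, 0, 7, 1)%N) /\
     (t = BI -> cards = (9, 0, 8, 1)%N)).
Proof.
have [t_ok data] := generators_mckay rG_faithful rG_SL2 gensG.
have cxP c := classes_cxP c data.
have cx0 : (forall i, i < rank t -> tau_nat t i = i) -> classes_cx G = set0.
  move=> fix_tau; apply/setP => c; rewrite in_set0; apply/cxP => -[i /andP[lt_i]].
  by rewrite fix_tau // eqxx.
exists (tau_perm t); split.
  by split=> [|s]; [exact: is_tau_perm | exact: is_tau_unique].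
split; first by case: data.
split; first by rewrite (classes_reE data) (classes_cxE data).
have cards_data := mckay_cards data.
split.
  split=> [k k_gt0 tE|].
    apply/setP => c; apply/cxP/imsetP; rewrite tE /=.
    - case=> i /andP[lt_i _] ->; rewrite nth_powers //.
      have lt_i1 : i.+1 < 2 * k + 1 by lia.
      by exists (Ordinal lt_i1); rewrite ?inE.
    - case=> -[i lt_i]; rewrite inE /= => i_gt0 ->.
      by exists i.-1; [lia | rewrite nth_powers ?prednK //; lia].
  split=> [k tE|].
    apply/setP => c; apply/cxP/imsetP; rewrite tE /=.
    - case=> i /andP[lt_i taui] ->; rewrite nth_powers //.
      have lt_i1 : i.+1 < 2 * k by lia.
      by exists (Ordinal lt_i1) => //; rewrite inE /=; lia.
    - case=> -[i lt_i]; rewrite inE /= => /andP[i_gt0 i_k] ->.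
      by exists i.-1; [lia | rewrite nth_powers ?prednK //; lia].
  split=> [k k_gt0 tE|].
    have n_gt0 : 0 < 2 * k + 1 by lia.
    apply/setP => c; rewrite in_set2; apply/cxP/orP; rewrite tE.
    - case=> i /andP[_ taui] ->.
      have [->|->] : i = (2 * k + 1)%N \/ i = (2 * k + 1).+1.
        by move: taui; rewrite /tau_nat; lia_if.
      + by right; rewrite nth_labels_BA.
      + by left; rewrite nth_labels_B.
    - case=> /eqP->; [exists (2 * k + 1).+1 | exists (2 * k + 1)%N];
        rewrite ?nth_labels_B ?nth_labels_BA //; rewrite /rank /tau_nat; lia_if.
  split=> [tE|].
    apply/setP => c; rewrite !in_setU !in_set1 -!orbA; apply/cxP/or4P; rewrite tE.
    - case=> -[|[|[|[|[|[|i]]]]]] //= _ ->; rewrite eqxx.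
      + by constructor 2.
      + by constructor 4.
      + by constructor 3.
      + by constructor 1.
    - case=> /eqP->; [exists 4 | exists 0%N | exists 3 | exists 1%N] => //.
  by split=> [k|]; [|split] => tE; apply: cx0; rewrite tE //; apply: tau_nat_BD_even.
move=> cards.
have cardsE : cards = ((rank t).+1, moved t, rank t - moved t, #[tau_perm t]).
  by rewrite /cards cards_data.
rewrite {cards}cardsE.
split=> [k k_gt0 ->|].
  rewrite (@tau_perm_order2 _ 0%N) ?moved_ZZ_odd /=; try lia.
  by congr (_, _, _, _); lia.
split=> [->|].
  by rewrite tau_perm_order1.
split=> [k k_gt1 ->|].
  rewrite (@tau_perm_order2 _ 0%N) ?moved_ZZ_even /=; try lia.
  by congr (_, _, _, _); lia.
split=> [->|].
  by rewrite tau_perm_order1 => [|[|i]].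
split=> [k ->|].
  have fix_tau := @tau_nat_BD_even k.
  by rewrite (tau_perm_order1 fix_tau) (moved0 fix_tau) /=; congr (_, _, _, _); lia.
split=> [k ->|].
  have n_odd : odd (2 * k + 1) by lia.
  have lt_end : 2 * k + 1 < rank (BD (2 * k + 1)) by rewrite /rank; lia.
  have tau_end : tau_nat (BD (2 * k + 1)) (2 * k + 1) != (2 * k + 1)%N.
    by rewrite /tau_nat n_odd eqxx; lia.
  rewrite (tau_perm_order2 lt_end tau_end) moved_BD_odd // /rank.
  by congr (_, _, _, _); lia.
split=> [->|].
  by rewrite (@tau_perm_order2 _ 0%N).
by split=> ->; rewrite tau_perm_order1.
Qed.
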